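(* Let $K$ be a field and let $I,J\subset K[x_1,\ldots,x_n]$ be equigenerated monomial ideals of height $n$. Then: (a) If $n=3$, then $IJ$ is Freiman if and only if $I=J=(x_1^d,x_2^d,x_3^d)$ for some integer $d\ge 1$. (b) If $n\ge 4$, then $IJ$ is not Freiman.
   Context: $\mathfrak m=(x_1,\ldots,x_n)\subset S=K[x_1,\ldots,x_n]$. For a graded ideal $L\subset S$, $\mu(L)$ denotes the minimal number of generators of $L$; the fiber cone is $F(L)=\bigoplus_{k\ge 0} L^k/\mathfrak m L^k$, and the analytic spread $\ell(L)$ is the Krull dimension of $F(L)$. An ideal is equigenerated if all elements of a minimal set of generators have the same degree. An equigenerated monomial ideal $L$ is called Freiman if $\mu(L^2)=\ell(L)\mu(L)-\binom{\ell(L)}{2}$. *)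

(* Defs.v *)
From HB Require Import structures.
From mathcomp Require Import all_boot all_order all_algebra.
From mathcomp Require Import boolp classical_sets.
From mathcomp Require Import mpoly.

Set Implicit Arguments.
Unset Strict Implicit.
Unset Printing Implicit Defensive.

Import GRing.Theory.
Local Open Scope ring_scope.
Local Open Scope classical_set_scope.

Section IdealArithmetic.
Variable R : comNzRingType.
Implicit Types (I J L P : set R) (s t : seq R).

Definition ideal_span (A : set R) : set R :=
  [set f | exists2 s : seq (R * R),
     (forall p, p \in s -> A p.2) & f = \sum_(p <- s) p.1 * p.2].

Definition ideal_prod I J : set R :=
  ideal_span [set f | exists g h, [/\ I g, J h & f = g * h]].

Fixpoint ideal_pow L (k : nat) : set R :=
  if k is k'.+1 then ideal_prod L (ideal_pow L k') else setT.

Definition min_num_gens L (m : nat) : Prop :=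
  (exists2 s, size s = m & ideal_span [set` s] = L) /\
  (forall s, ideal_span [set` s] = L -> (m <= size s)%N).

Definition minimal_gens L s : Prop :=
  [/\ uniq s, ideal_span [set` s] = L &
      forall t, {subset t <= s} -> ideal_span [set` t] = L -> {subset s <= t}].

(* [idealr_closed] includes 1 \notin P, so prime ideals are proper. *)
Definition prime_ideal P : Prop :=
  idealr_closed (fun x => x \in P) /\ prime_idealr_closed (fun x => x \in P).

(* Q_0 < Q_1 < ... < Q_d, a chain of length d (only Q_0, ..., Q_d matter) *)
Definition prime_chain (d : nat) (Q : nat -> set R) : Prop :=
  (forall i, (i <= d)%N -> prime_ideal (Q i)) /\
  (forall i, (i < d)%N -> Q i `<` Q i.+1).

Definition has_krull_dim (d : nat) : Prop :=
  (exists Q, prime_chain d Q) /\ (forall e Q, prime_chain e Q -> (e <= d)%N).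

Definition has_prime_height P (h : nat) : Prop :=
  (exists2 Q, prime_chain h Q & Q h = P) /\
  (forall e Q, prime_chain e Q -> Q e = P -> (e <= h)%N).

(* Minimum of the heights of the primes containing I; the unit ideal has no
   (finite) height. *)
Definition has_height I (h : nat) : Prop :=
  (exists P, [/\ prime_ideal P, I `<=` P & has_prime_height P h]) /\
  (forall P e, prime_ideal P -> I `<=` P -> has_prime_height P e -> (h <= e)%N).

Lemma ideal_span_sub (A : set R) f : A f -> ideal_span A f.
Proof.
move=> Af; exists [:: (1, f)]; last by rewrite big_seq1 mul1r.
by move=> p; rewrite inE => /eqP->.
Qed.

Lemma ideal_span0 (A : set R) : ideal_span A 0.
Proof. by exists [::]; rewrite ?big_nil. Qed.

Lemma ideal_spanD (A : set R) f g :
  ideal_span A f -> ideal_span A g -> ideal_span A (f + g).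
Proof.
move=> [s sA ->] [t tA ->]; exists (s ++ t); last by rewrite big_cat.
by move=> p; rewrite mem_cat => /orP[/sA|/tA].
Qed.

Lemma ideal_spanM (A : set R) a f : ideal_span A f -> ideal_span A (a * f).
Proof.
move=> [s sA ->]; exists [seq (a * p.1, p.2) | p <- s].
  by move=> _ /mapP[p /sA Ap ->].
by rewrite big_map mulr_sumr; apply: eq_bigr => p _; rewrite mulrA.
Qed.

Lemma ideal_span_sum (A : set R) (T : Type) (r : seq T) (Q : pred T)
    (F : T -> R) :
  (forall i, Q i -> ideal_span A (F i)) -> ideal_span A (\sum_(i <- r | Q i) F i).
Proof.
by move=> AF; apply: big_ind => //; [exact: ideal_span0|exact: ideal_spanD].
Qed.

Lemma ideal_span_ind (A B : set R) f :
  B 0 -> (forall x y, B x -> B y -> B (x + y)) ->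
  (forall a x, A x -> B (a * x)) -> ideal_span A f -> B f.
Proof.
move=> B0 BD BM [s sA ->]; rewrite big_seq; apply: big_ind => // p /sA.
exact: BM.
Qed.

Lemma ideal_pow0 L k : ideal_pow L k 0.
Proof. by case: k => //= k; exact: ideal_span0. Qed.

Lemma ideal_powD L k f g :
  ideal_pow L k f -> ideal_pow L k g -> ideal_pow L k (f + g).
Proof. by case: k => //= k; exact: ideal_spanD. Qed.

Lemma ideal_powMl L k a f : ideal_pow L k f -> ideal_pow L k (a * f).
Proof. by case: k => //= k; exact: ideal_spanM. Qed.

Lemma ideal_prodMr I J J' a f :
  (forall h, J h -> J' (h * a)) -> ideal_prod I J f -> ideal_prod I J' (f * a).
Proof.
move=> JJ'; apply: (@ideal_span_ind _ (fun f => ideal_prod I J' (f * a))).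
- by rewrite mul0r; exact: ideal_span0.
- by move=> x y Ix Iy; rewrite mulrDl; exact: ideal_spanD.
move=> b x [g [h [Ig Jh ->]]]; rewrite -!mulrA; apply: ideal_spanM.
by apply: ideal_span_sub; exists g, (h * a); split=> //; exact: JJ'.
Qed.

Lemma ideal_powM L i j f g :
  ideal_pow L i f -> ideal_pow L j g -> ideal_pow L (i + j) (f * g).
Proof.
move=> + Lg; elim: i f => [|i IHi] f; first by move=> _; exact: ideal_powMl.
by rewrite addSn /=; apply: ideal_prodMr => h; exact: IHi.
Qed.

End IdealArithmetic.

Section ReesAlgebra.
Variables (R : comNzRingType) (L : set R).

(* R[Lt] as the subring of R[t] of the polynomials whose coefficient of t^k
   lies in L^k *)
Definition rees_pred : {pred {poly R}} :=
  fun p => `[< forall k, ideal_pow L k p`_k >].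

Lemma rees_subring_closed : subring_closed rees_pred.
Proof.
split.
- apply/asboolP => -[//|k]; rewrite coef1; exact: ideal_pow0.
- move=> p q /asboolP Lp /asboolP Lq; apply/asboolP => k.
  by rewrite coefB -mulN1r; apply: ideal_powD => //; exact: ideal_powMl.
move=> p q /asboolP Lp /asboolP Lq; apply/asboolP => k; rewrite coefM.
apply: big_ind => [||i _]; [exact: ideal_pow0|by move=> *; exact: ideal_powD|].
by have := ideal_powM (Lp i) (Lq (k - i)%N); rewrite subnKC // -ltnS.
Qed.

HB.instance Definition _ :=
  GRing.isSubringClosed.Build {poly R} rees_pred rees_subring_closed.

Record rees := Rees { rees_val : {poly R}; _ : rees_val \in rees_pred }.

HB.instance Definition _ := [isSub for rees_val].
HB.instance Definition _ := [Choice of rees by <:].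
HB.instance Definition _ := [SubChoice_isSubComNzRing of rees by <:].

End ReesAlgebra.

Lemma rees_val0 (R : comNzRingType) (L : set R) : rees_val (0 : rees L) = 0.
Proof. exact: (raddf0 (\val : rees L -> {poly R})). Qed.

Lemma rees_val1 (R : comNzRingType) (L : set R) : rees_val (1 : rees L) = 1.
Proof. exact: (rmorph1 (\val : rees L -> {poly R})). Qed.

Lemma rees_valD (R : comNzRingType) (L : set R) (p q : rees L) :
  rees_val (p + q) = rees_val p + rees_val q.
Proof. exact: (raddfD (\val : rees L -> {poly R})). Qed.

Lemma rees_valM (R : comNzRingType) (L : set R) (p q : rees L) :
  rees_val (p * q) = rees_val p * rees_val q.
Proof. exact: (rmorphM (\val : rees L -> {poly R})). Qed.

Section FiberCone.
Variables (K : fieldType) (n : nat).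
Local Notation S := {mpoly K[n]}.
Implicit Types L : set S.

Definition irrelevant_ideal : set S := ideal_span [set f | exists i, f = 'X_i].

Lemma irrelevant_ideal_coef0 f : irrelevant_ideal f -> f@_0%MM = 0.
Proof.
apply: (@ideal_span_ind _ _ (fun f => f@_0%MM = 0)).
- exact: mcoeff0.
- by move=> x y x0 y0; rewrite mcoeffD x0 y0 addr0.
move=> a _ [i ->]; rewrite (rmorphM (mcoeff 0%MM)) /= mcoeffX mnm1_eq0.
by rewrite mulr0.
Qed.

(* the ideal \bigoplus_k m L^k of the Rees algebra \bigoplus_k L^k *)
Definition fiber_ideal L : {pred rees L} :=
  fun p => `[< forall k,
    ideal_prod irrelevant_ideal (ideal_pow L k) (rees_val p)`_k >].

Arguments fiber_ideal L : clear implicits.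

Lemma fiber_ideal_closed L : idealr_closed (fiber_ideal L).
Proof.
split.
- by apply/asboolP => k; rewrite rees_val0 coef0; exact: ideal_span0.
- apply/negP => /asboolP /(_ 0%N); rewrite rees_val1 coef1 eqxx => m1.
  have: (1 : S)@_0%MM = 0.
    apply: irrelevant_ideal_coef0; move: m1.
    apply: ideal_span_ind => [||a x [g [h [mg _ ->]]]].
    + exact: ideal_span0.
    + by move=> x y; exact: ideal_spanD.
    by rewrite [g * h]mulrC mulrA; exact: ideal_spanM.
  by rewrite mcoeff1 eqxx => /eqP; rewrite oner_eq0.
move=> a u v /asboolP mu /asboolP mv; apply/asboolP => k.
rewrite rees_valD rees_valM coefD; apply: ideal_spanD; last exact: mv.
rewrite coefM; apply: ideal_span_sum => i _; rewrite mulrC.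
apply: ideal_prodMr (mu _) => h Lh; rewrite mulrC.
have La : ideal_pow L i (rees_val a)`_i by case: (a) => p /= /asboolP; exact.
by have := ideal_powM La Lh; rewrite subnKC // -ltnS.
Qed.

HB.instance Definition _ L :=
  isIdealr.Build (rees L) (fiber_ideal L) (fiber_ideal_closed L).

Definition fiber_cone L : comNzRingType := {ideal_quot (fiber_ideal L)}.

Definition analytic_spread L (l : nat) : Prop := has_krull_dim (fiber_cone L) l.

Definition monomial_ideal L : Prop :=
  exists A : set 'X_{1..n}, L = ideal_span [set f | exists2 m, A m & f = 'X_[m]].

(* For a graded ideal, "minimal set of generators" means one consisting of
   homogeneous elements. *)
Definition equigenerated L : Prop :=
  exists (s : seq S) (d : nat),
    minimal_gens L s /\ (forall f, f \in s -> f \is d.-homog).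

(* The relations [analytic_spread] and [min_num_gens] are functional.  The
   equation is stated in int because the subtraction of nat is truncated. *)
Definition freiman L : Prop :=
  [/\ monomial_ideal L, equigenerated L &
      exists l m m2 : nat,
        [/\ analytic_spread L l, min_num_gens L m,
            min_num_gens (ideal_pow L 2) m2 &
            m2%:Z = l%:Z * m%:Z - 'C(l, 2)%:Z]].

Definition pure_power_ideal (d : nat) : set S :=
  ideal_span [set f | exists i : 'I_n, f = 'X_i ^+ d].

End FiberCone.

Arguments pure_power_ideal K n d : clear implicits.

(* Main.v *)
Require Import Defs.
From HB Require Import structures.
From mathcomp Require Import all_boot all_order all_algebra.
From mathcomp Require Import boolp classical_sets.
From mathcomp Require Import mpoly generic_quotient ring_quotient.
From mathcomp Require Import zify ring.

(** The fiber cone of an ideal [L] generated by monomials [X^m], [m] in [M],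
    of a common degree [c] is the algebra of the semigroup generated by [M].
    When [M] contains the exponents [c e_i] of all the powers [X_i ^ c], this
    algebra has dimension [n] ([analytic_spread_mideal]).  So [L] is Freiman if
    and only if [|M + M| = n |M| - C(n, 2)].  Now the right hand side is exactly
    the size of the union of the translates [c e_i + M], because two of them
    only meet in [c e_i + c e_j]; as that union is contained in [M + M], being
    Freiman means that every [u + v] with [u], [v] in [M] is some [c e_i + w]
    with [w] in [M] ([freiman_count], [freiman_mideal]).  In particular some
    coordinate of [u + v] is at least [c].

    Height [n] forces an equigenerated monomial ideal to contain a power of each
    variable, necessarily of the generating degree ([full_height_mideal]).  For
    [I J] with generating degrees [a] and [b] this gives [c = a + b] and
    [M = A + B], where [A] contains the [a e_i] and [B] the [b e_i], and a few
    sums in [M + M] decide everything.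
    - If four distinct indices exist, [(a e_i + b e_j) + (a e_k + b e_l)] has no
      coordinate as large as [a + b].
    - With three indices, [(a e_i + b e_j) + (a e_k + b e_j)] forces
      [a + b <= 2 b]; exchanging the factors, [a = b].  If [m] in [A] were not a
      pure power, all coordinates of [(m + b e_i) + (a e_j + b e_k)] would be
      below [2 a].
    Conversely, for [n = 3] and [A = B = {d e_1, d e_2, d e_3}], a sum of four
    of the [d e_i] repeats one of them, which provides the summand [2 d e_i].

    Krull dimensions are bounded above through algebraic dependence: any
    [n + 1] elements of [K[X_1, ..., X_n]] satisfy a polynomial relation
    ([mpoly_algebraic_dependence], by counting monomials), whereas elements
    [x_i] chosen in [Q (i + 1)] but not in [Q i], for a chain of primes [Q], do
    not satisfy any ([prime_chain_independent]).  The same bound on the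
    dimension of the polynomial ring gives the statement on heights. *)

Set Implicit Arguments.
Unset Strict Implicit.
Unset Printing Implicit Defensive.

Import GRing.Theory.
Local Open Scope ring_scope.
Local Open Scope classical_set_scope.
Local Open Scope quotient_scope.

(** * Chains of prime ideals *)

Section PrimeIdeals.
Variable R : comNzRingType.
Implicit Types (P : set R) (Q : nat -> set R).

Lemma prime_idealP P :
  prime_ideal P <->
  [/\ P 0, ~ P 1, forall u v, P u -> P v -> P (u + v),
      forall a u, P u -> P (a * u) & forall u v, P (u * v) -> P u \/ P v].
Proof.
have inP x : (x \in (fun y => y \in P)) = `[< P x >] by [].
split=> [[[]]|[P0 P1 PD PM Pprime]].
  rewrite !inP => /asboolP P0 /asboolP P1 Pid Pprime; split=> //.
  - move=> u v Pu Pv; apply/asboolP; rewrite -inP -[u]mul1r.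
    by apply: Pid; rewrite inP; apply/asboolP.
  - move=> a u Pu; apply/asboolP; rewrite -inP -[a * u]addr0.
    by apply: Pid; rewrite inP; apply/asboolP.
  move=> u v Puv; have := Pprime u v; rewrite !inP => /(_ (asboolT Puv)).
  by move=> /orP[] /asboolP; [left|right].
split; [split|]; rewrite ?inP.
- exact/asboolP.
- exact/asboolP.
- move=> a u v; rewrite !inP => /asboolP Pu /asboolP Pv.
  by apply/asboolP/PD => //; exact: PM.
move=> u v; rewrite !inP => /asboolP /Pprime[] Pu; apply/orP.
  by left; exact/asboolP.
by right; exact/asboolP.
Qed.

Lemma prime_kernel (D : idomainType) (f : {rmorphism R -> D}) :
  prime_ideal [set x | f x = 0].
Proof.
apply/prime_idealP; split=> /=.
- exact: rmorph0.
- by move/eqP; rewrite rmorph1 oner_eq0.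
- by move=> u v fu fv; rewrite rmorphD fu fv addr0.
- by move=> a u fu; rewrite rmorphM fu mulr0.
by move=> u v /eqP; rewrite rmorphM mulf_eq0 => /orP[] /eqP; [left|right].
Qed.

Lemma prime_chain_has_height (P : set R) h :
  prime_ideal P -> (forall e Q, prime_chain e Q -> Q e = P -> (e <= h)%N) ->
  exists2 e, (e <= h)%N & has_prime_height P e.
Proof.
move=> Pp bound.
pose good e := `[< exists2 Q, prime_chain e Q & Q e = P >].
have good0 : exists e, good e.
  by exists 0%N; apply/asboolP; exists (fun=> P) => //; split.
have goodb e : good e -> (e <= h)%N by move=> /asboolP[Q]; exact: bound.
case: (ex_maxnP good0 goodb) => e /asboolP ge emax.
exists e; first by apply/goodb/asboolP.
by split=> // e' Q chQ QP; apply: emax; apply/asboolP; exists Q.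
Qed.

Lemma has_krull_dim_uniq d e : has_krull_dim R d -> has_krull_dim R e -> d = e.
Proof.
move=> [[Q chQ] maxd] [[Q' chQ'] maxe].
by apply/eqP; rewrite eqn_leq (maxe _ _ chQ) (maxd _ _ chQ').
Qed.

(** The [x i] are algebraically independent over [K] modulo [Q 0].  Among the
    monomials of a relation, keep those with least exponent of the first
    variable, then, among these, those with least exponent of the second, and so
    on; each step divides by a power of [x_i], which lies outside the prime
    [Q i], and discards multiples of [x_i], which lie in [Q i.+1].  A nonzero
    constant would remain in the last prime. *)
Lemma prime_chain_independent (K : fieldType) (psi : {rmorphism K -> R})
    (k : nat) (Q : nat -> set R) (x : 'I_k -> R) (p : {mpoly K[k]}) :
  prime_chain k Q ->
  (forall i : 'I_k, Q i.+1 (x i) /\ ~ Q i (x i)) ->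
  p != 0 -> ~ Q 0%N (mmap psi x p).
Proof.
move=> [Qp Qlt] Qx p0.
suff claim d i (s : seq 'X_{1..k}) : (i + d = k)%N -> uniq s -> s != [::] ->
    {subset s <= msupp p} ->
    {in s &, forall m m' : 'X_{1..k},
       forall j : 'I_k, (j < i)%N -> m j = m' j} ->
    ~ Q i (\sum_(m <- s) psi p@_m * \prod_(j < k | (i <= j)%N) x j ^+ m j).
  by apply: (claim k 0%N) => //; rewrite ?msupp_uniq // msupp_eq0.
elim: d i s => [|d IHd] i s; rewrite ?addn0 => ik us s0 sp seqs.
  rewrite {}ik in seqs *.
  case: s s0 us sp seqs => [//|m s] _ /= /andP[ms _] sp seqs.
  have -> : s = [::].
    case: s ms sp seqs => // m' s ms _ seqs.
    move: ms; rewrite inE => /norP[/eqP[]]; apply/mnmP => j.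
    by apply: seqs; rewrite ?inE ?eqxx ?orbT.
  rewrite big_seq1 big_pred0 ?mulr1; last by move=> j; rewrite leqNgt ltn_ord.
  have /prime_idealP[_ Q1 _ QM _] := Qp k (leqnn k).
  move=> /(QM (psi (p@_m)^-1)); rewrite -rmorphM mulVf ?rmorph1 //.
  by rewrite -mcoeff_msupp sp ?mem_head.
have lt_ik : (i < k)%N by lia.
pose oi := Ordinal lt_ik.
have exa : exists a, has (fun m : 'X_{1..k} => m oi == a) s.
  by case: s s0 {us sp seqs} => // m s _; exists (m oi) => /=; rewrite eqxx.
case: (ex_minnP exa) => a hasa mina.
pose s' := [seq m : 'X_{1..k} <- s | m oi == a].
pose T (m : 'X_{1..k}) := \prod_(j < k | (i < j)%N) x j ^+ m j.
have prodE (m : 'X_{1..k}) :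
    \prod_(j < k | (i <= j)%N) x j ^+ m j = x oi ^+ m oi * T m.
  rewrite (bigD1 oi) //=; congr (_ * _); apply: eq_bigl => j.
  by rewrite ltn_neqAle andbC; congr (_ && _); rewrite eq_sym -val_eqE.
have sumE : \sum_(m <- s) psi p@_m * \prod_(j < k | (i <= j)%N) x j ^+ m j =
    x oi ^+ a * (\sum_(m <- s') psi p@_m * T m + x oi *
       \sum_(m <- s | m oi != a) psi p@_m * (x oi ^+ (m oi - a).-1 * T m)).
  rewrite (bigID (fun m : 'X_{1..k} => m oi == a)) /= mulrDr; congr (_ + _).
    rewrite big_filter mulr_sumr; apply: eq_bigr => m /eqP ma.
    by rewrite prodE ma mulrCA.
  rewrite !mulr_sumr big_seq_cond [RHS]big_seq_cond.
  apply: eq_bigr => m /andP[ms ma].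
  have lt_am : (a < m oi)%N.
    rewrite ltn_neqAle eq_sym ma; apply: mina; apply/hasP; exists m => //.
  have mE : m oi = (a + (1 + (m oi - a).-1))%N by lia.
  by rewrite prodE {1}mE !exprD expr1; ring.
have /prime_idealP[_ Qi1 _ _ Qipr] := Qp _ (ltnW lt_ik).
have /prime_idealP[_ _ QD QM _] := Qp _ lt_ik.
have [Qx1 Qx0] := Qx oi.
rewrite sumE => /Qipr[|].
  elim: a {hasa mina s' sumE} => [/Qi1 //|a IHa].
  by rewrite exprS => /Qipr[].
case: (Qlt _ lt_ik) => Qss _ /Qss QT.
apply: (IHd i.+1 s'); rewrite ?addSnnS //.
- exact: filter_uniq.
- by rewrite -size_eq0 -lt0n size_filter -has_count.
- by move=> m; rewrite mem_filter => /andP[_ /sp].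
- move=> m m'; rewrite !mem_filter => /andP[/eqP ma ms] /andP[/eqP ma' ms'] j.
  rewrite ltnS leq_eqVlt => /orP[/eqP ji|]; last exact: seqs.
  have -> : j = oi by apply: val_inj; rewrite /= ji.
  by rewrite ma ma'.
set U := \sum_(m <- s | _) _ in QT.
have := QD _ _ QT (QM (- U) _ Qx1).
by rewrite mulNr [in X in - X]mulrC addrK.
Qed.
End PrimeIdeals.

(** * Algebraic dependence and the dimension of polynomial rings *)

Section AlgebraicDependence.
Variables (K : fieldType) (n : nat).
Local Notation S := {mpoly K[n]}.

Lemma mdeg_mmap1_le k (f : 'I_k -> S) (D : nat) (e : 'X_{1..k}) :
  (forall i, {in msupp (f i), forall m, (mdeg m <= D)%N}) ->
  {in msupp (mmap1 f e), forall m, (mdeg m <= mdeg e * D)%N}.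
Proof.
move=> fD; rewrite /mmap1 mdegE big_distrl /=.
pose bd d (g : S) := {in msupp g, forall m, (mdeg m <= d)%N}.
have bd1 : bd 0%N 1 by move=> m; rewrite msupp1 inE => /eqP ->; rewrite mdeg0.
have bdM d d' g h : bd d g -> bd d' h -> bd (d + d')%N (g * h).
  move=> gd hd m /msuppM_le /allpairsP[[u v] /= [/gd gu /hd hv ->]].
  by rewrite mdegD leq_add.
rewrite -/(bd _ _); apply: (big_rec2 (fun d g => bd d g)) => // i d g _.
apply: (bdM); elim: (e i) => [|j IHj] //.
by rewrite exprS mulSn; apply: (bdM) => //; exact: fD.
Qed.

(** The [N ^ (n + 1)] monomials in the [f i] of partial degrees below [N] span
    a space of polynomials whose degree is linear in [N], hence of dimension
    O([N ^ n]), so they are linearly dependent for large [N]. *)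
Lemma mpoly_algebraic_dependence (f : 'I_n.+1 -> S) :
  exists2 p : {mpoly K[n.+1]}, p != 0 & mmap (@mpolyC n K) f p = 0.
Proof.
pose D := \max_(i < n.+1) msize (f i).
pose C := (n.+1 * D + 1)%N; pose N := (C ^ n).+1; pose B := (n.+1 * N * D).+1.
have fD i : {in msupp (f i), forall m, (mdeg m <= D)%N}.
  move=> m /msize_mdeg_lt /ltnW mi; apply: leq_trans mi _.
  by rewrite /D (bigmax_sup i).
pose T1 := {ffun 'I_n.+1 -> 'I_N}; pose T2 := {ffun 'I_n -> 'I_B}.
pose mon1 (e : T1) := [multinom (e i : nat) | i < n.+1].
pose mon2 (e : T2) := [multinom (e i : nat) | i < n].
have mon1_inj : injective mon1.
  move=> e e' /mnmP ee'; apply/ffunP => i; apply: val_inj.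
  by have := ee' i; rewrite !mnmE.
have mon1_deg e : (mdeg (mon1 e) <= n.+1 * N)%N.
  rewrite mdegE -[X in (_ <= X * _)%N]card_ord -sum_nat_const leq_sum // => i _.
  by rewrite mnmE ltnW.
have lt_card : (#|T2| < #|T1|)%N.
  rewrite !card_ffun !card_ord; apply: (@leq_ltn_trans ((C * N) ^ n)).
    have leB : (B <= C * N)%N.
      by rewrite /B /C mulnDl mul1n -addn1 leq_add // mulnAC.
    elim: (X in (_ ^ X <= _ ^ X)%N) => // k.
    by rewrite !expnS => /(leq_mul leB).
  by rewrite expnMn expnS ltn_pmul2r ?expn_gt0 // ltnSn.
pose A := \matrix_(i < #|T1|, j < #|T2|)
  (mmap1 f (mon1 (enum_val i)))@_(mon2 (enum_val j)).
have : kermx A != 0.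
  rewrite kermx_eq0 /row_free neq_ltn; apply/orP; left.
  exact: leq_ltn_trans (rank_leq_col A) lt_card.
move=> /rowV0Pn[v /sub_kermxP vA v0].
pose p := \sum_i v 0 i *: 'X_[mon1 (enum_val i)] : {mpoly K[n.+1]}.
have pE i : p@_(mon1 (enum_val i)) = v 0 i.
  rewrite raddf_sum (bigD1 i) //= mcoeffZ mcoeffX eqxx mulr1.
  rewrite big1 ?addr0 // => j ji; rewrite mcoeffZ mcoeffX.
  case: eqP => [/mon1_inj/enum_val_inj ij|_]; last exact: mulr0.
  by rewrite ij eqxx in ji.
exists p.
  apply: contraNneq v0 => p0; apply/eqP/rowP => i.
  by rewrite -pE p0 mcoeff0 mxE.
have -> : mmap (@mpolyC n K) f p = \sum_i v 0 i *: mmap1 f (mon1 (enum_val i)).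
  rewrite raddf_sum; apply: eq_bigr => i _.
  by rewrite /= mmapZ mmapX mul_mpolyC.
apply/mpolyP => m; rewrite mcoeff0 raddf_sum /=.
have [/forallP m_lt|/forallPn[j mj]] := boolP [forall j : 'I_n, m j < B]%N.
  pose e : T2 := [ffun j => Ordinal (m_lt j)].
  have <- : mon2 e = m by apply/mnmP => j; rewrite mnmE ffunE.
  have := congr1 (fun u : 'rV_ _ => u 0 (enum_rank e)) vA; rewrite !mxE => vAe.
  rewrite -[RHS]vAe.
  by apply: eq_bigr => i _; rewrite mcoeffZ !mxE enum_rankK.
(* An exponent of [m] reaches [B], beyond the degree of any of the products. *)
apply: big1 => i _; rewrite mcoeffZ; apply/eqP.
rewrite mulf_eq0; apply/orP; right.
rewrite -[_ == 0]negbK -mcoeff_msupp.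
apply: contra mj => /(mdeg_mmap1_le fD) md.
rewrite ltnS; apply: leq_trans (_ : (mdeg m <= _)%N).
  by rewrite mdegE (bigD1 j) //= leq_addr.
by apply: leq_trans md _; rewrite leq_mul2r mon1_deg orbT.
Qed.

(** Subalgebras of [K[X_1, ..., X_n]] have dimension at most [n]: along a longer
    chain of primes one could choose [n + 1] elements that are both independent
    and dependent. *)
Lemma prime_chain_le (R : comNzRingType) (psi : {rmorphism K -> R})
    (phi : {rmorphism R -> S}) (e : nat) (Q : nat -> set R) :
  (forall c, phi (psi c) = c%:MP) ->
  (forall x, phi x = 0 -> x = 0) ->
  prime_chain e Q -> (e <= n)%N.
Proof.
move=> phipsi phi0 [Qp Qlt]; rewrite leqNgt; apply/negP => lt_ne.
have exx (i : 'I_n.+1) : {x | Q i.+1 x /\ ~ Q i x}.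
  apply: cid; have [_ nsub] := Qlt i (leq_trans (ltn_ord i) lt_ne).
  by move/existsNP: nsub => [x /not_implyP]; exists x.
pose x (i : 'I_n.+1) := sval (exx i).
have [p p0 pf] := mpoly_algebraic_dependence (phi \o x).
have chQ : prime_chain n.+1 Q.
  by split=> i ile; [apply: Qp|apply: Qlt]; exact: leq_trans lt_ne.
have xP (i : 'I_n.+1) : Q i.+1 (x i) /\ ~ Q i (x i) := svalP (exx i).
apply: (prime_chain_independent (psi := psi) chQ xP p0).
suff -> : mmap psi x p = 0 by case/prime_idealP: (Qp 0%N isT).
apply: phi0; rewrite -[RHS]pf /mmap raddf_sum; apply: eq_bigr => m _.
rewrite /= rmorphM phipsi; congr (_ * _).
by rewrite rmorph_prod; apply: eq_bigr => i _; rewrite rmorphXn.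
Qed.
End AlgebraicDependence.

(** * Monomial ideals *)

Lemma ideal_span_le (R : comNzRingType) (A B : set R) :
  A `<=` ideal_span B -> ideal_span A `<=` ideal_span B.
Proof.
move=> AB f; apply: ideal_span_ind; first exact: ideal_span0.
  by move=> x y; exact: ideal_spanD.
by move=> a x /AB; exact: ideal_spanM.
Qed.

Section MonomialIdeals.
Variables (K : fieldType) (n : nat).
Local Notation S := {mpoly K[n]}.
Implicit Types (A B M : set 'X_{1..n}) (f g : S).

Definition mideal A : set S :=
  ideal_span [set f | exists2 m, A m & f = 'X_[m]].

Lemma midealP A f :
  mideal A f <-> {in msupp f, forall m, exists2 a, A a & (a <= m)%MM}.
Proof.
split=> [|Af].
  apply: (@ideal_span_ind _ _
    (fun f => {in msupp f, forall m, exists2 a, A a & (a <= m)%MM})).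
  - by move=> m; rewrite msupp0.
  - by move=> x y Ax Ay m /msuppD_le; rewrite mem_cat => /orP[/Ax|/Ay].
  move=> b _ [a Aa ->] m /msuppM_le /allpairsP[[u v] /= [_ /mem_msuppXP <- ->]].
  by exists a => //; exact: lem_addl.
rewrite [f]mpolyE big_seq; apply: ideal_span_sum => m /Af[a Aa am].
rewrite -(submK am) mpolyXD scalerAl; apply: ideal_spanM.
by apply: ideal_span_sub; exists a.
Qed.

Lemma midealX A m : mideal A 'X_[m] <-> exists2 a, A a & (a <= m)%MM.
Proof.
rewrite midealP; split=> [|Am] => [/(_ m)|m' /mem_msuppXP <- //].
by rewrite msuppX inE eqxx => /(_ isT).
Qed.

Lemma mem_mideal A m : A m -> mideal A 'X_[m].
Proof. by move=> Am; apply: ideal_span_sub; exists m. Qed.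

Definition msumset A B : set 'X_{1..n} := [set (a + b)%MM | a in A & b in B].

Lemma msumsetC A B : msumset A B = msumset B A.
Proof.
by rewrite eqEsubset; split=> _ [a Aa [b Bb <-]]; exists b => //; exists a;
  rewrite // addmC.
Qed.

Lemma mideal_prod A B :
  ideal_prod (mideal A) (mideal B) = mideal (msumset A B).
Proof.
rewrite eqEsubset; split; apply: ideal_span_le => f.
  move=> [g [h [/midealP gA /midealP hB ->]]]; apply/midealP => m.
  move=> /msuppM_le /allpairsP[[u v] /= [/gA[a Aa au] /hB[b Bb bv] ->]].
  exists (a + b)%MM; first by exists a => //; exists b.
  by apply/mnm_lepP => i; rewrite !mnmDE leq_add //; apply/mnm_lepP.
move=> [_ [a Aa [b Bb <-]] ->]; apply: ideal_span_sub.
by exists 'X_[a], 'X_[b]; rewrite mpolyXD; split=> //; exact: mem_mideal.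
Qed.

Fixpoint mpowset A k : set 'X_{1..n} :=
  if k is k'.+1 then msumset A (mpowset A k') else [set 0%MM].

Lemma mideal_pow A k : ideal_pow (mideal A) k = mideal (mpowset A k).
Proof.
elim: k => [|k IHk] /=; last by rewrite IHk mideal_prod.
rewrite eqEsubset; split=> // f _; apply/midealP => m _.
by exists 0%MM => //; apply/mnm_lepP => i; rewrite mnm0E.
Qed.

Lemma mpowset_mdeg A d k m :
  (forall m, A m -> mdeg m = d) -> mpowset A k m -> mdeg m = (k * d)%N.
Proof.
move=> Ad; elim: k m => [|k IHk] m /=; first by move=> ->; rewrite mdeg0.
by move=> [a Aa [b Bb <-]]; rewrite mdegD (Ad a) // (IHk b) // mulSn.
Qed.

Lemma equigenerated_mideal (L : set S) :
  monomial_ideal L -> equigenerated L ->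
  exists d M, (forall m, M m -> mdeg m = d) /\ L = mideal M.
Proof.
move=> [A LA] [s [d [[_ sL _] sd]]].
have {}LA : L = mideal A by [].
exists d, [set m | mdeg m = d /\ L 'X_[m]]; split; first by move=> m [].
rewrite eqEsubset; split; last first.
  rewrite [X in _ `<=` X]LA; apply: ideal_span_le => _ [m [_ +] ->].
  by rewrite LA.
rewrite -[X in X `<=` _]sL; apply: ideal_span_le => f /= fs.
apply/midealP => m mf.
exists m; last exact: lepm_refl.
split; first exact: (dhomogP _ _ _ (sd _ fs)).
have : L f by rewrite -sL; exact: ideal_span_sub.
by rewrite LA => /midealP /(_ m mf) /midealX.
Qed.

(** * Primes generated by variables, and monomial ideals of full height *)

(** Its kernel is the prime ideal generated by the variables in [T]. *)
Definition kill_vars (T : pred 'I_n) : S -> S :=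
  mmap (@mpolyC n K) (fun i => if T i then 0 else 'X_i).

HB.instance Definition _ T := GRing.RMorphism.on (kill_vars T).

Lemma mcoeff_kill T f m :
  (kill_vars T f)@_m = if [exists i, T i && (m i != 0%N)] then 0 else f@_m.
Proof.
have killX u : kill_vars T 'X_[u] =
    if [exists i, T i && (u i != 0%N)] then 0 else 'X_[u].
  rewrite /kill_vars mmapX /mmap1; case: existsP => [[i /andP[Ti ui]]|noT].
    by rewrite (bigD1 i) //= Ti expr0n (negPf ui) mul0r.
  rewrite mpolyXE_id; apply: eq_bigr => i _; case: ifP => // Ti.
  have [->|ui] := eqVneq (u i) 0%N; first by rewrite !expr0.
  by case: noT; exists i; rewrite Ti.
have killE : kill_vars T f = \sum_(u <- msupp f) f@_u *: kill_vars T 'X_[u].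
  rewrite [f in LHS]mpolyE (raddf_sum (kill_vars T)); apply: eq_bigr => u _.
  by rewrite /= /kill_vars mmapZ mul_mpolyC.
have coefX u : (f@_u *: kill_vars T 'X_[u])@_m = f@_u * (u == m)%:R *
    (~~ [exists i, T i && (m i != 0%N)])%:R.
  rewrite mcoeffZ killX -mulrA; congr (_ * _).
  case: (eqVneq u m) => [->|um].
    by rewrite mul1r; case: ifP; rewrite ?mcoeff0 ?mcoeffX ?eqxx.
  by rewrite mul0r; case: ifP; rewrite ?mcoeff0 // mcoeffX (negPf um).
rewrite killE raddf_sum /= (eq_bigr _ (fun u _ => coefX u)) -mulr_suml.
have -> : \sum_(u <- msupp f) f@_u * (u == m)%:R = f@_m.
  rewrite [in RHS](mpolyE f) raddf_sum /=; apply: eq_bigr => u _.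
  by rewrite mcoeffZ mcoeffX.
by case: ifP; rewrite ?mulr0 ?mulr1.
Qed.

Lemma kill_eq0P T f :
  kill_vars T f = 0 <->
  {in msupp f, forall m : 'X_{1..n}, exists i, T i /\ m i != 0%N}.
Proof.
split=> [Tf m mf|Tf].
  have := congr1 (mcoeff m) Tf; rewrite mcoeff_kill mcoeff0.
  case: existsP => [[i /andP[Ti mi]]|_]; first by exists i.
  by move/eqP; rewrite mcoeff_eq0 mf.
apply/mpolyP => m; rewrite mcoeff_kill mcoeff0; case: existsP => // noT.
apply/eqP; rewrite mcoeff_eq0; apply/negP => /Tf[i [Ti mi]].
by apply: noT; exists i; rewrite Ti.
Qed.

Lemma prime_chain_mpoly_le e (Q : nat -> set S) : prime_chain e Q -> (e <= n)%N.
Proof. exact: (@prime_chain_le K n S (@mpolyC n K) idfun). Qed.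

(** Without a power of [X_i], the ideal lies in the prime generated by the
    other variables; that prime is not maximal, so its height is less than the
    dimension [n] of the ring. *)
Lemma full_height_pure_powers M :
  has_height (mideal M) n -> forall i, exists2 k, (0 < k)%N & M (U_(i) *+ k)%MM.
Proof.
move=> [[P0 [P0p MP0 _]] minht] i.
suff [k Mk] : exists k, M (U_(i) *+ k)%MM.
  exists k => //; rewrite lt0n; apply/eqP => k0.
  have /prime_idealP[_ + _ _ _] := P0p; apply; apply: MP0.
  by rewrite -mpolyX0; apply: mem_mideal; rewrite k0 in Mk.
apply: contrapT => noM.
pose P := [set f | kill_vars (predC1 i) f = 0].
have Pp : prime_ideal P by exact: prime_kernel.
have MP : mideal M `<=` P.
  move=> f /midealP Mf; apply/kill_eq0P => m /Mf[a Ma /mnm_lepP am].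
  have [/existsP[j /andP[ji aj]]|/existsPn ai] :=
    boolP [exists j, (j != i) && (a j != 0%N)].
    exists j; split=> //; move: (am j); rewrite -!lt0n.
    by apply: leq_trans; rewrite lt0n.
  case: noM; exists (a i); congr M: Ma; apply/mnmP => j.
  rewrite mulmnE mnm1E; have := ai j; rewrite negb_and !negbK eq_sym.
  by case: eqP => [->|_ /= /eqP ->]; rewrite ?mul1n.
have [e le_en /(minht _ _ Pp MP)] :
    exists2 e, (e <= n.-1)%N & has_prime_height P e.
  apply: prime_chain_has_height => // e Q [Qp Qlt] QP.
  pose Pmax := [set f | kill_vars predT f = 0].
  pose Q' k := if (k <= e)%N then Q k else Pmax.
  suff /prime_chain_mpoly_le : prime_chain e.+1 Q' by case: (n).
  split=> k; rewrite /Q'.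
    by case: ifP => [/Qp//|_ _]; exact: prime_kernel.
  rewrite ltnS; case: ltngtP => // [ke|->] _; first exact: Qlt.
  rewrite QP; split=> [f /kill_eq0P Pf|XP].
    by apply/kill_eq0P => m /Pf[j [_ mj]]; exists j.
  have /kill_eq0P/(_ U_(i)%MM) : P 'X_i.
    apply: XP; apply/kill_eq0P => m /mem_msuppXP <-.
    by exists i; rewrite mnm1E eqxx.
  rewrite msuppX inE eqxx => /(_ isT)[j [/= ji]].
  by rewrite mnm1E (eq_sym i) (negPf ji).
by have := ltn_ord i; lia.
Qed.
End MonomialIdeals.

(** * The dimension of the fiber cone *)

Section KrullDimension.
Variables (K : fieldType) (n : nat).
Local Notation S := {mpoly K[n]}.

(** The lower bound comes from the primes of [K[X_1, ..., X_n]]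
    generated by the first [i] variables: the powers of the variables in the
    subalgebra keep their traces distinct. *)
Lemma subalgebra_krull_dim (R : comNzRingType) (psi : {rmorphism K -> R})
    (phi : {rmorphism R -> S}) (c : nat) (x : 'I_n -> R) :
  (forall a, phi (psi a) = a%:MP) -> (forall y, phi y = 0 -> y = 0) ->
  (0 < c)%N -> (forall i, phi (x i) = 'X_i ^+ c) ->
  has_krull_dim R n.
Proof.
move=> phipsi phi0 c0 phix; split; last first.
  by move=> e Q; exact: prime_chain_le phi0.
pose ltp i : pred 'I_n := fun j => (j < i)%N.
exists (fun i => [set y | kill_vars (ltp i) (phi y) = 0]); split=> i le_in.
  exact: (@prime_kernel _ _ (kill_vars (ltp i) \o phi)).
split=> [y /kill_eq0P yi|sub].
  by apply/kill_eq0P => m /yi[j [ji mj]]; exists j; split=> //; exact: ltnW.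
have /kill_eq0P/(_ (U_(Ordinal le_in) *+ c)%MM) :
    kill_vars (ltp i) (phi (x (Ordinal le_in))) = 0.
  apply: sub; apply/kill_eq0P => m; rewrite phix mpolyXn => /mem_msuppXP <-.
  exists (Ordinal le_in); rewrite mulmnE mnm1E eqxx mul1n -lt0n; split=> //.
  exact: ltnSn.
rewrite phix mpolyXn msuppX inE eqxx => /(_ isT)[j []].
rewrite mulmnE mnm1E /ltp; case: (Ordinal le_in =P j) => [<-|//].
by rewrite /= ltnn.
Qed.
End KrullDimension.

Section FiberCone.
Variables (K : fieldType) (n : nat).
Local Notation S := {mpoly K[n]}.
Local Notation pihomog := (pihomog (@mdeg n)).
Implicit Types (f g : S).

Lemma mcoeff_pihomog d f m :
  (pihomog d f)@_m = if mdeg m == d then f@_m else 0.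
Proof.
rewrite pihomogE raddf_sum /=.
under eq_bigr => u _ do rewrite mcoeffZ mcoeffX.
case: ifP => [md|md].
  rewrite [in RHS](mpolyE f) raddf_sum /=.
  rewrite [RHS](bigID (fun u => mdeg u == d)) /=.
  rewrite [X in _ = _ + X]big1 ?addr0 => [|u ud].
    by apply: eq_bigr => u _; rewrite mcoeffZ mcoeffX.
  rewrite mcoeffZ mcoeffX; case: eqP => [um|_]; last by rewrite mulr0.
  by rewrite um md in ud.
apply: big1 => u ud; case: eqP => [um|_]; last by rewrite mulr0.
by rewrite -um ud in md.
Qed.

Definition order_ge d f := {in msupp f, forall m, (d <= mdeg m)%N}.

(** Degree [d] parts are multiplicative on polynomials without terms of lower
    degree. *)
Lemma pihomogM d e f g :
  order_ge d f -> order_ge e g ->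
  pihomog (d + e) (f * g) = pihomog d f * pihomog e g.
Proof.
move=> fd ge; apply/mpolyP => m; rewrite mcoeff_pihomog !mcoeffM.
have lowf u : (mdeg u < d)%N -> f@_u = 0.
  move=> ud; apply/eqP; rewrite mcoeff_eq0; apply/negP => /fd; lia.
have lowg u : (mdeg u < e)%N -> g@_u = 0.
  move=> ue; apply/eqP; rewrite mcoeff_eq0; apply/negP => /ge; lia.
case: ifP => md.
  apply: eq_bigr => -[u v] /= /eqP muv; rewrite !mcoeff_pihomog.
  have {}md : (mdeg u + mdeg v = d + e)%N by rewrite -mdegD -muv; apply/eqP.
  case: (ltngtP (mdeg u) d) => ud; first by rewrite lowf // !mul0r.
    by rewrite lowg ?mulr0 ?mul0r //; lia.
  by case: eqP => // ve; rewrite lowg ?mulr0 //; lia.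
rewrite big1 // => -[u v] /= /eqP muv; rewrite !mcoeff_pihomog.
case: eqP => ud; rewrite ?mul0r //; case: eqP => ve; rewrite ?mulr0 //.
by rewrite [in mdeg m]muv mdegD ud ve eqxx in md.
Qed.

Variables (M : set 'X_{1..n}) (c : nat).
Hypothesis Mc : forall m, M m -> mdeg m = c.
Let L : set S := mideal M.

Lemma ideal_pow_order k f : ideal_pow L k f -> order_ge (k * c) f.
Proof.
rewrite /L mideal_pow => /midealP Mf m.
move=> /Mf[a /(mpowset_mdeg Mc) <- /mnm_lepP am].
by rewrite !mdegE leq_sum.
Qed.

Lemma irrelevant_mulE k :
  ideal_prod (@irrelevant_ideal K n) (ideal_pow L k) =
  mideal (msumset [set U_(i)%MM | i in setT] (mpowset M k)).
Proof.
have -> : @irrelevant_ideal K n = mideal [set U_(i)%MM | i in setT].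
  congr ideal_span; rewrite eqEsubset; split=> f [i].
    by move=> ->; exists U_(i)%MM => //; exists i.
  by move=> [j _ <-] ->; exists j.
by rewrite /L mideal_pow mideal_prod.
Qed.

Lemma pihomog_eq0_irrelevant k f :
  ideal_pow L k f ->
  (pihomog (k * c) f = 0 <->
   ideal_prod (@irrelevant_ideal K n) (ideal_pow L k) f).
Proof.
rewrite irrelevant_mulE => Lf; split=> [f0|/midealP mLf].
  move: Lf; rewrite /L mideal_pow => /midealP Lf; apply/midealP => m mf.
  have [a Ma am] := Lf m mf; have adeg := mpowset_mdeg Mc Ma.
  have [i ai] : exists i, (a i < m i)%N.
    apply: contrapT => /forallNP ma; have am' : a = m.
      apply/mnmP => i; apply/eqP; rewrite eqn_leq (mnm_lepP am) leqNgt.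
      exact/negP/ma.
    have := congr1 (mcoeff m) f0; rewrite mcoeff_pihomog mcoeff0 -am' adeg eqxx.
    by move/eqP; rewrite mcoeff_eq0 am' mf.
  exists (U_(i) + a)%MM; first by exists U_(i)%MM; [exists i|exists a].
  apply/mnm_lepP => j; rewrite mnmDE mnm1E; have := mnm_lepP am j.
  by case: eqP => [<-|_].
apply/mpolyP => m; rewrite mcoeff_pihomog mcoeff0; case: eqP => // md.
apply/eqP; rewrite mcoeff_eq0; apply/negP => /mLf[_ [_ [i _ <-] [a Ma <-]]].
move=> /mnm_lepP le_m.
have : (mdeg (U_(i) + a) <= mdeg m)%N by rewrite !mdegE leq_sum.
by rewrite mdegD mdeg1 (mpowset_mdeg Mc Ma) md; lia.
Qed.

(** On [L ^ k] all terms have degree at least [k c], and those of degree exactly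
    [k c] represent the class modulo [m L ^ k].  This map from the Rees algebra
    is thus multiplicative with kernel the fiber ideal. *)
Definition initial_poly (p : rees L) : {poly S} :=
  \poly_(k < size (rees_val p)) pihomog (k * c) (rees_val p)`_k.

Lemma coef_initial_poly p k :
  (initial_poly p)`_k = pihomog (k * c) (rees_val p)`_k.
Proof.
by rewrite coef_poly; case: ltnP => // pk; rewrite nth_default // raddf0.
Qed.

Lemma rees_coef (p : rees L) k : ideal_pow L k (rees_val p)`_k.
Proof. by case: p => p /= /asboolP. Qed.

Lemma rees_valB (p q : rees L) : rees_val (p - q) = rees_val p - rees_val q.
Proof. exact: (raddfB (\val : rees L -> {poly S})). Qed.

Lemma initial_polyB p q :
  initial_poly (p - q) = initial_poly p - initial_poly q.
Proof.
by apply/polyP => k; rewrite coefB !coef_initial_poly rees_valB coefB raddfB.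
Qed.

Lemma initial_polyM p q :
  initial_poly (p * q) = initial_poly p * initial_poly q.
Proof.
apply/polyP => k; rewrite coefM coef_initial_poly rees_valM coefM raddf_sum.
apply: eq_bigr => i _; rewrite !coef_initial_poly -pihomogM.
- by rewrite -mulnDl subnKC // -ltnS.
- exact/ideal_pow_order/rees_coef.
exact/ideal_pow_order/rees_coef.
Qed.

Lemma initial_polyC p a :
  rees_val p = (a%:MP)%:P -> initial_poly p = (a%:MP)%:P.
Proof.
move=> pa; apply/polyP => k; rewrite coef_initial_poly pa coefC.
case: eqP => [->|_]; last by rewrite raddf0.
rewrite mul0n pihomog_dE //; apply/dhomogP => m; rewrite msuppC.
by case: ifP => // _; rewrite inE => /eqP ->; exact: mdeg0.
Qed.

Lemma fiber_idealE p : p \in @fiber_ideal K n L <-> initial_poly p = 0.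
Proof.
split=> [/asboolP pI|p0].
  apply/polyP => k; rewrite coef_initial_poly coef0.
  by apply/pihomog_eq0_irrelevant; [exact: rees_coef|exact: pI].
apply/asboolP => k; apply/pihomog_eq0_irrelevant; first exact: rees_coef.
by rewrite -coef_initial_poly p0 coef0.
Qed.

Local Notation quot := {ideal_quot (@fiber_ideal K n L)}.

(** Evaluating at [1] loses nothing, since the coefficients are homogeneous of
    distinct degrees: the fiber cone is the subalgebra of [K[X_1, ..., X_n]]
    generated by the monomials of [M]. *)
Definition fiber_embed (x : fiber_cone L) : S :=
  (initial_poly (repr (x : quot))).[1].

Lemma fiber_embed_pi (p : rees L) :
  fiber_embed (\pi_quot p) = (initial_poly p).[1].
Proof.
have /fiber_idealE : repr (\pi_quot p) - p \in @fiber_ideal K n L.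
  by rewrite Quotient.idealrBE reprK.
rewrite initial_polyB => /eqP; rewrite subr_eq0 => /eqP ppi.
by rewrite /fiber_embed ppi.
Qed.

Lemma fiber_embed_zmod : zmod_morphism fiber_embed.
Proof.
move=> x y; have -> : x - y = \pi_quot (repr (x : quot) - repr (y : quot)).
  by rewrite rmorphB /= !reprK.
by rewrite fiber_embed_pi initial_polyB hornerD hornerN.
Qed.

Lemma fiber_embed_monoid : monoid_morphism fiber_embed.
Proof.
split=> [|x y].
  have -> : 1 = \pi_quot 1 :> fiber_cone L by rewrite rmorph1.
  by rewrite fiber_embed_pi (@initial_polyC _ 1) ?hornerC ?rees_val1 ?mpolyC1.
have -> : x * y = \pi_quot (repr (x : quot) * repr (y : quot)).
  by rewrite rmorphM /= !reprK.
by rewrite fiber_embed_pi initial_polyM hornerM.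
Qed.

Hypothesis c0 : (0 < c)%N.

Lemma fiber_embed_eq0 x : fiber_embed x = 0 -> x = 0.
Proof.
rewrite /fiber_embed; set p := repr _ => p0.
have ip0 : initial_poly p = 0.
  apply/polyP => k; rewrite coef0 coef_initial_poly.
  have := congr1 (pihomog (k * c)) p0.
  rewrite raddf0 horner_coef raddf_sum /=.
  have pk i : pihomog (k * c) ((initial_poly p)`_i * 1 ^+ i) =
      if i == k then pihomog (k * c) (rees_val p)`_k else 0.
    rewrite expr1n mulr1 coef_initial_poly.
    case: eqP => [->|ik]; first by rewrite pihomog_id.
    apply: (pihomog_ne0 (d := (i * c)%N)); last exact: pihomogP.
    by rewrite eqn_pmul2r //; apply/eqP.
  under eq_bigr => i _ do rewrite pk.
  have [lt_k|le_k _] := ltnP k (size (initial_poly p)).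
    rewrite (bigD1 (Ordinal lt_k)) //= eqxx big1 ?addr0 // => i.
    by rewrite -val_eqE /= => /negPf ->.
  by rewrite -coef_initial_poly nth_default.
have /fiber_idealE : initial_poly (p - 0) = 0.
  by rewrite subr0.
rewrite Quotient.idealrBE reprK.
by rewrite rmorph0 => /eqP.
Qed.

Lemma rees_polyC_subproof (a : S) : a%:P \in rees_pred L.
Proof.
by apply/asboolP => -[//|k]; rewrite coefC; exact: (ideal_pow0 L k.+1).
Qed.

Definition rees_polyC (a : S) : rees L := Rees (rees_polyC_subproof a).

Definition fiber_scalar (a : K) : fiber_cone L := \pi_quot (rees_polyC a%:MP).

Lemma fiber_scalar_zmod : zmod_morphism fiber_scalar.
Proof.
move=> a b; rewrite /fiber_scalar -rmorphB /=; congr \pi; apply: val_inj.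
by rewrite [RHS]rees_valB /= mpolyCB polyCB.
Qed.

Lemma fiber_scalar_monoid : monoid_morphism fiber_scalar.
Proof.
split=> [|a b]; rewrite /fiber_scalar.
  have -> : rees_polyC 1%:MP = 1.
    by apply: val_inj; rewrite [RHS]rees_val1 /= mpolyC1.
  by rewrite rmorph1.
rewrite -rmorphM /=; congr \pi; apply: val_inj.
by rewrite [RHS]rees_valM /= mpolyCM polyCM.
Qed.

Hypothesis Mpow : forall i, M (U_(i) *+ c)%MM.

Lemma rees_pow_subproof i : ('X_i ^+ c)%:P * 'X \in rees_pred L.
Proof.
apply/asboolP => k; rewrite coefMX coefC; case: k => [//|k] /=.
case: eqP => [->|_]; last exact: (ideal_pow0 L k.+1).
rewrite -[ideal_prod _ _]/(ideal_pow L 1) /L mideal_pow mpolyXn.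
by apply: mem_mideal; exists (U_(i) *+ c)%MM => //; exists 0%MM; rewrite ?addm0.
Qed.

Lemma analytic_spread_mideal : analytic_spread L n.
Proof.
pose psi : {rmorphism K -> fiber_cone L} := HB.pack fiber_scalar
  (GRing.isZmodMorphism.Build _ _ _ fiber_scalar_zmod)
  (GRing.isMonoidMorphism.Build _ _ _ fiber_scalar_monoid).
pose phi : {rmorphism fiber_cone L -> S} := HB.pack fiber_embed
  (GRing.isZmodMorphism.Build _ _ _ fiber_embed_zmod)
  (GRing.isMonoidMorphism.Build _ _ _ fiber_embed_monoid).
pose x i : fiber_cone L := \pi_quot (Rees (rees_pow_subproof i)).
apply: (@subalgebra_krull_dim _ _ _ psi phi c x) => //.
- move=> a; rewrite [LHS]fiber_embed_pi (@initial_polyC _ a) //.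
  by rewrite hornerC.
- exact: fiber_embed_eq0.
move=> i; rewrite [LHS]fiber_embed_pi.
have -> : initial_poly (Rees (rees_pow_subproof i)) = ('X_i ^+ c)%:P * 'X.
  apply/polyP => k; rewrite coef_initial_poly /= coefMX coefC.
  case: eqP => [|k0]; first by rewrite raddf0.
  case: eqP => [k1|_]; last by rewrite raddf0.
  rewrite pihomog_dE //; have -> : k = 1%N by lia.
  by rewrite mul1n mpolyXn dhomogX /= mdegMn mdeg1 mul1n.
by rewrite hornerMX hornerC mulr1.
Qed.
End FiberCone.

(** * Minimal generators of equigenerated monomial ideals *)

Section MinimalGenerators.
Variables (K : fieldType) (n : nat).
Local Notation S := {mpoly K[n]}.
Implicit Types (s : seq 'X_{1..n}).

Lemma min_num_gens_uniq (R : comNzRingType) (L : set R) a b :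
  min_num_gens L a -> min_num_gens L b -> a = b.
Proof.
move=> [[s <- sL] mina] [[t <- tL] minb].
by apply/eqP; rewrite eqn_leq mina // minb.
Qed.

Lemma ideal_span_mpolyX s :
  ideal_span [set` [seq 'X_[m] : S | m <- s]] = @mideal K n [set` s].
Proof.
congr ideal_span; rewrite eqEsubset; split=> f /=.
  by move=> /mapP[m ms ->]; exists m.
by move=> [m ms ->]; exact: map_f.
Qed.

Lemma pihomog0E (f : S) : pihomog (@mdeg n) 0 f = (f@_0%MM)%:MP.
Proof.
apply/mpolyP => m; rewrite mcoeff_pihomog mcoeffC mdeg_eq0 eq_sym.
by case: eqP => [->|_]; rewrite ?mulr1 ?mulr0.
Qed.

(** The degree [d] parts of any generating system span over the field the
    space with basis the monomials of [s]: higher terms of the coefficients only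
    contribute in degrees above [d]. *)
Lemma min_num_gens_mideal s d :
  uniq s -> {in s, forall m, mdeg m = d} ->
  min_num_gens (@mideal K n [set` s]) (size s).
Proof.
move=> us sd; split.
  by exists [seq 'X_[m] | m <- s]; rewrite ?size_map ?ideal_span_mpolyX.
move=> t tL.
pose v (f : S) : 'rV[K]_(size s) := \row_j f@_(nth 0%MM s j).
pose T := \matrix_(i < size t) v (nth 0 t i).
have vD f g : v (f + g) = v f + v g by apply/rowP => j; rewrite !mxE mcoeffD.
have vM a f : @mideal K n [set` s] f -> v (a * f) = a@_0%MM *: v f.
  move=> /midealP sf; apply/rowP => j; rewrite !mxE.
  have jd : mdeg (nth 0%MM s j) = d by rewrite sd ?mem_nth.
  have fd : order_ge d f.
    by move=> m /sf[u /sd <- /mnm_lepP um]; rewrite !mdegE leq_sum.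
  have a0 : order_ge 0 a by [].
  have := congr1 (mcoeff (nth 0%MM s j)) (pihomogM a0 fd).
  by rewrite pihomog0E mul_mpolyC mcoeffZ !mcoeff_pihomog jd eqxx.
have vT f : @mideal K n [set` s] f -> (v f <= T)%MS.
  rewrite -[in mideal _]tL.
  apply: (@ideal_span_ind _ _ (fun f => (v f <= T)%MS)).
  - rewrite (_ : v 0 = 0) ?sub0mx //; by apply/rowP => j; rewrite !mxE mcoeff0.
  - by move=> x y xT yT; rewrite vD addmx_sub.
  move=> a x /= xt; rewrite vM; last by rewrite -tL; exact: ideal_span_sub.
  apply: scalemx_sub; have lt_i : (index x t < size t)%N by rewrite index_mem.
  rewrite -[x](nth_index 0 xt) -[index x t]/(nat_of_ord (Ordinal lt_i)).
  by rewrite -(rowK (fun i => v (nth 0 t i))) row_sub.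
have : (1%:M <= T)%MS.
  apply/row_subP => i; rewrite (_ : row i 1%:M = v 'X_[nth 0%MM s i]).
    by apply: vT; apply: mem_mideal; rewrite /= mem_nth.
  by apply/rowP => j; rewrite !mxE mcoeffX nth_uniq.
move/mxrankS; rewrite mxrank1 => /leq_trans; apply; exact: rank_leq_row.
Qed.

Lemma minimal_gens_mideal s d :
  uniq s -> {in s, forall m, mdeg m = d} ->
  minimal_gens (@mideal K n [set` s]) [seq 'X_[m] | m <- s].
Proof.
move=> us sd; split; first 1 last.
- exact: ideal_span_mpolyX.
- move=> t ts tL _ /mapP[m ms ->].
  pose s' := [seq m <- s | 'X_[m] \in t].
  have : @mideal K n [set` s'] 'X_[m].
    have : @mideal K n [set` s] 'X_[m] by exact: mem_mideal.
    rewrite -tL -ideal_span_mpolyX; apply: ideal_span_le => f /= ft.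
    apply: ideal_span_sub; have /mapP[u us' fu] := ts _ ft.
    by rewrite /= fu map_f // mem_filter -fu ft.
  move=> /midealX[u /=]; rewrite mem_filter => /andP[ut us'] um.
  suff -> : m = u by [].
  rewrite -(submK um); have : (mdeg (m - u) == 0)%N.
    by rewrite -(eqn_add2r (mdeg u)) -mdegD submK // add0n !sd.
  by rewrite mdeg_eq0 => /eqP ->; rewrite add0m.
rewrite map_inj_uniq // => u w uw.
have := congr1 (mcoeff u) uw; rewrite !mcoeffX eqxx.
by case: eqP => // _ /eqP; rewrite oner_eq0.
Qed.
End MinimalGenerators.

(** * Counting sums of exponents *)

Section SumsetCount.
Variables (n c : nat) (s : seq 'X_{1..n}).
Hypothesis c0 : (0 < c)%N.
Hypothesis us : uniq s.
Hypothesis sc : {in s, forall m, mdeg m = c}.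
Let e (i : 'I_n) := (U_(i) *+ c)%MM.
Hypothesis es : forall i, e i \in s.

Definition sumset_seq := undup [seq (u + v)%MM | u <- s, v <- s].

Lemma pure_power_inj : injective e.
Proof.
move=> i j /mnmP/(_ i); rewrite !mulmnE !mnm1E eqxx mul1n.
by case: (j =P i) => [->//|_]; move: c0; rewrite mul0n; lia.
Qed.

(* Adding [e i] to the removed points would give sums already obtained from the
   previous [e j]; this leaves each sum with one decomposition. *)
Let rest (i : 'I_n) :=
  [seq m <- s | m \notin [seq e j | j <- take i (enum 'I_n)]].

Let shifts := [seq (e i + m)%MM | i <- enum 'I_n, m <- rest i].

Lemma size_rest (i : 'I_n) : (i + size (rest i))%N = size s.
Proof.
set X := [seq e j | j <- take i (enum 'I_n)].
have uX : uniq X.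
  by rewrite map_inj_uniq ?take_uniq ?enum_uniq //; exact: pure_power_inj.
have sX : size X = i by rewrite size_map size_take size_enum_ord ltn_ord.
rewrite -(count_predC (mem X) s) -!size_filter; congr addn.
rewrite -sX; apply/perm_size/uniq_perm => //; first exact: filter_uniq.
move=> m; rewrite mem_filter /= andb_idr // => /mapP[j _ ->]; exact: es.
Qed.

Lemma mem_take_enum_ord (i j : 'I_n) : (j \in take i (enum 'I_n)) = (j < i)%N.
Proof.
by rewrite in_take ?mem_enum // index_enum_ord.
Qed.

Lemma mem_rest i m :
  (m \in rest i) = (m \in s) && ~~ [exists j : 'I_n, (j < i)%N && (m == e j)].
Proof.
rewrite mem_filter andbC; congr (_ && ~~ _).
apply/mapP/existsP => [[j ji ->]|[j /andP[ji /eqP ->]]].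
  by exists j; rewrite eqxx andbT -mem_take_enum_ord.
by exists j => //; rewrite mem_take_enum_ord.
Qed.

(** An element of [s] with a coordinate as large as its degree [c] is a pure
    power; so two translates only meet in [e i + e j]. *)
Lemma translate_collision i j u v :
  u \in s -> v \in s -> i != j -> (e i + u = e j + v)%MM -> u = e j.
Proof.
move=> us' vs ij /mnmP eq_uv.
have uj : (c <= u j)%N.
  have := eq_uv j; rewrite !mnmDE !mulmnE !mnm1E eqxx (negPf ij); lia.
have := sc us'; rewrite mdegE (bigD1 j) //= => sum_u.
have u0 k : k != j -> u k = 0%N.
  move=> kj; move: sum_u; rewrite (bigD1 k) //=; lia.
apply/mnmP => k; rewrite mulmnE mnm1E; case: eqVneq => [<-|jk].
  by move: sum_u; rewrite big1 // mul1n; lia.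
by rewrite u0 // eq_sym.
Qed.

Lemma shifts_uniq : uniq shifts.
Proof.
apply: allpairs_uniq_dep.
- exact: enum_uniq.
- by move=> i _; exact: filter_uniq.
have restP (p : {i : 'I_n & 'X_{1..n}}) :
    p \in [seq @Tagged _ i (fun=> 'X_{1..n}) m | i <- enum 'I_n, m <- rest i] ->
    tagged p \in s /\ forall j : 'I_n, (j < tag p)%N -> tagged p != e j.
  move=> /allpairsPdep[i [u [_ ui ->]]] /=; move: ui; rewrite mem_rest.
  move=> /andP[us' /existsPn iu]; split=> // j ji.
  by have := iu j; rewrite ji.
move=> [i u] [j v] /restP[/= us' ui] /restP[/= vs vj] eq_uv.
have [ij|ij] := eqVneq i j.
  by move: eq_uv; rewrite ij => /addmI ->.
have uj := translate_collision us' vs ij eq_uv.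
have vi : v = e i.
  rewrite eq_sym in ij.
  exact: (translate_collision vs us' ij (esym eq_uv)).
have [lt_ij|lt_ji|/val_inj eq_ij] := ltngtP i j.
- by have := vj i lt_ij; rewrite vi eqxx.
- by have := ui j lt_ji; rewrite uj eqxx.
by rewrite eq_ij eqxx in ij.
Qed.

Lemma mem_shifts x :
  reflect (exists i, exists2 w, w \in s & x = (e i + w)%MM) (x \in shifts).
Proof.
apply: (iffP allpairsPdep) => [[i [w [_ + ->]]]|[i [w ws ->]]].
  by rewrite mem_rest => /andP[ws _]; exists i, w.
have [/existsP[j /andP[ji /eqP wj]]|wrest] :=
    boolP [exists j : 'I_n, (j < i)%N && (w == e j)].
  exists j, (e i); rewrite mem_enum mem_rest es wj addmC; split=> //.
  apply/existsPn => k; rewrite negb_and -leqNgt.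
  by case: eqP => [/pure_power_inj <-|]; rewrite ?orbT // ltnW.
by exists i, w; rewrite mem_enum mem_rest ws wrest.
Qed.

Lemma size_shifts : (size shifts + 'C(n, 2) = n * size s)%N.
Proof.
rewrite size_allpairs_dep sumnE big_map big_enum /=.
rewrite -bin2_sum big_mkord -big_split /=.
rewrite (eq_bigr (fun=> size s)) => [|i _]; last by rewrite addnC size_rest.
by rewrite sum_nat_const card_ord.
Qed.

(** The union of the translates [e i + s] has [n |s| - C(n, 2)] elements and is
    contained in [s + s]; both conditions say that it is all of [s + s]. *)
Lemma freiman_count :
  ((size sumset_seq + 'C(n, 2))%N = (n * size s)%N) <->
  {in s &, forall u v, exists i, exists2 w, w \in s & (u + v = e i + w)%MM}.
Proof.
have sub : {subset shifts <= sumset_seq}.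
  move=> _ /mem_shifts[i [w ws ->]]; rewrite mem_undup.
  by apply/allpairsP; exists (e i, w); rewrite es ws.
rewrite -size_shifts; split=> [/addIn sz|full].
  have [_ eqm] := uniq_min_size shifts_uniq sub (eq_leq sz).
  move=> u v us' vs; apply/mem_shifts; rewrite eqm mem_undup.
  by apply/allpairsP; exists (u, v).
congr (_ + _)%N; apply/eqP; rewrite eqn_leq.
rewrite (uniq_leq_size shifts_uniq sub) uniq_leq_size ?undup_uniq //.
move=> x; rewrite mem_undup => /allpairsP[[u v] /= [us' vs ->]].
by apply/mem_shifts/full.
Qed.
End SumsetCount.

(** * Freiman ideals containing powers of the variables *)

Section FreimanCriterion.
Variables (K : fieldType) (n c : nat) (M : set 'X_{1..n}).
Hypothesis c0 : (0 < c)%N.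
Hypothesis Mc : forall m, M m -> mdeg m = c.
Hypothesis Mpow : forall i, M (U_(i) *+ c)%MM.

Lemma finite_mdeg_set : exists2 s : seq 'X_{1..n}, uniq s & M = [set` s].
Proof.
exists [seq val m | m <- enum [pred m : 'X_{1..n < c.+1} | `[< M (val m) >]]].
  by rewrite map_inj_uniq ?enum_uniq //; exact: val_inj.
rewrite eqEsubset; split=> m /=.
  move=> Mm; have lt_m : (mdeg m < c.+1)%N by rewrite (Mc Mm).
  apply/mapP; exists (BMultinom lt_m) => //.
  by rewrite mem_enum inE.
by move=> /mapP[u]; rewrite mem_enum inE => Mu ->.
Qed.

(** The analytic spread being [n], the Freiman equation compares the sizes of
    [M] and [M + M].  The condition on exponents means that the square of the
    ideal is its product with the ideal of the [X_i ^ c]. *)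
Lemma freiman_mideal :
  freiman (mideal M : set {mpoly K[n]}) <->
  forall u v, M u -> M v ->
    exists i, exists2 w, M w & (u + v = U_(i) *+ c + w)%MM.
Proof.
have [s us Ms] := finite_mdeg_set.
have sc : {in s, forall m, mdeg m = c} by move=> m ms; apply: Mc; rewrite Ms.
have es i : (U_(i) *+ c)%MM \in s by have := Mpow i; rewrite Ms.
have spread : analytic_spread (mideal M : set {mpoly K[n]}) n.
  exact: analytic_spread_mideal Mc c0 Mpow.
have gens : min_num_gens (mideal M : set {mpoly K[n]}) (size s).
  by rewrite Ms; exact: min_num_gens_mideal sc.
have gens2 : min_num_gens (ideal_pow (mideal M : set {mpoly K[n]}) 2)
    (size (sumset_seq s)).
  rewrite mideal_pow (_ : mpowset M 2 = [set` sumset_seq s]).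
    apply: (@min_num_gens_mideal _ _ _ (c + c)); first exact: undup_uniq.
    move=> m; rewrite mem_undup => /allpairsP[[u v] /= [/sc uc /sc vc ->]].
    by rewrite mdegD uc vc.
  rewrite eqEsubset; split=> m /=.
    move=> [u Mu [v' [v Mv [_ -> <-]] <-]]; rewrite mem_undup addm0.
    by apply/allpairsP; exists (u, v); rewrite Ms in Mu Mv.
  rewrite mem_undup => /allpairsP[[u v] /= [su sv ->]].
  exists u; first by rewrite Ms.
  by exists v => //; exists v; [rewrite Ms|exists 0%MM; rewrite ?addm0].
have criterion := freiman_count c0 us sc es.
split=> [[_ _ [l [m [m2 [spr gm gm2 eqn]]]]] u v|full].
  have eqn' : (size (sumset_seq s) + 'C(n, 2) = n * size s)%N.
    move: eqn; rewrite (has_krull_dim_uniq spr spread).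
    rewrite (min_num_gens_uniq gm gens) (min_num_gens_uniq gm2 gens2) -PoszM.
    lia.
  rewrite Ms => su sv; exact: criterion.1 eqn' u v su sv.
split.
- by exists M.
- exists [seq 'X_[m] | m <- s], c; split.
    by rewrite Ms; exact: minimal_gens_mideal sc.
  by move=> _ /mapP[m /sc mc ->]; rewrite dhomogX; apply/eqP.
exists n, (size s), (size (sumset_seq s)); split=> //.
have {}full : {in s &, forall u v,
    exists i, exists2 w, w \in s & (u + v = U_(i) *+ c + w)%MM}.
  by move=> u v su sv; have := full u v; rewrite Ms; exact.
by have := criterion.2 full; rewrite -PoszM; lia.
Qed.
End FreimanCriterion.

(** * Exponents of a Freiman product *)

Section ProductExponents.
Variables (n a b : nat) (A B : set 'X_{1..n}).
Hypothesis a0 : (0 < a)%N.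
Hypothesis b0 : (0 < b)%N.
Hypothesis Aa : forall m, A m -> mdeg m = a.
Hypothesis Apow : forall i, A (U_(i) *+ a)%MM.
Hypothesis Bpow : forall i, B (U_(i) *+ b)%MM.
Hypothesis divides : forall u v, msumset A B u -> msumset A B v ->
  exists i, (a + b <= (u + v)%MM i)%N.

Let divides4 u u' v v' : A u -> B u' -> A v -> B v' ->
  exists i, (a + b <= u i + u' i + (v i + v' i))%N.
Proof.
move=> Au Bu' Av Bv'.
have [||i] := divides (u := (u + u')%MM) (v := (v + v')%MM).
- by exists u => //; exists u'.
- by exists v => //; exists v'.
by rewrite !mnmDE; exists i.
Qed.

(** Each coordinate of [(a e_i + b e_j) + (a e_k + b e_l)] is at most [a] or
    at most [b]. *)
Lemma no_four_variables (i j k l : 'I_n) : uniq [:: i; j; k; l] -> False.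
Proof.
rewrite /= !inE !negb_or.
move=> /and4P[/and3P[/eqP ij /eqP ik /eqP il] /andP[/eqP jk /eqP jl] /eqP kl _].
have [x] := divides4 (Apow i) (Bpow j) (Apow k) (Bpow l).
rewrite !mulmnE !mnm1E.
by do 4 (case: (_ =P x) => [?|_]); try congruence; lia.
Qed.

(** In [(a e_i + b e_j) + (a e_k + b e_j)] only the coordinate [2 b] can be as
    large as [a + b]. *)
Lemma degree_le (i j k : 'I_n) : uniq [:: i; j; k] -> (a <= b)%N.
Proof.
rewrite /= !inE !negb_or => /and3P[/andP[/eqP ij /eqP ik] /eqP jk _].
have [x] := divides4 (Apow i) (Bpow j) (Apow k) (Bpow j).
rewrite !mulmnE !mnm1E.
by do 3 (case: (_ =P x) => [?|_]); try congruence; lia.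
Qed.

(** If all coordinates of [m] were below [a], all those of
    [(m + b e_i) + (a e_j + b e_k)] would be below [2 a]. *)
Lemma pure_power_of_degree_eq (i j k : 'I_n) m :
  uniq [:: i; j; k] -> a = b -> A m -> exists x, m = (U_(x) *+ a)%MM.
Proof.
rewrite /= !inE !negb_or => /and3P[/andP[/eqP ij /eqP ik] /eqP jk _] ab Am.
apply: contrapT => /forallNP notpure.
have m_lt x : (m x < a)%N.
  rewrite ltnNge; apply/negP => le_ax; apply: (notpure x).
  have := Aa Am; rewrite mdegE (bigD1 x) //= => sum_m.
  apply/mnmP => y; rewrite mulmnE mnm1E; case: eqVneq => [<-|xy].
    lia.
  by move: sum_m; rewrite (bigD1 y) 1?eq_sym //=; lia.
have [x] := divides4 Am (Bpow i) (Apow j) (Bpow k).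
rewrite !mulmnE !mnm1E; have := m_lt x.
by do 3 (case: (_ =P x) => [?|_]); try congruence; lia.
Qed.
End ProductExponents.

(** * Products of monomial ideals of full height *)

Section PurePowers.
Variables (K : fieldType) (n : nat).

Definition pure_powers d : set 'X_{1..n} := [set (U_(i) *+ d)%MM | i in setT].

Lemma pure_power_idealE d : pure_power_ideal K n d = mideal (pure_powers d).
Proof.
congr ideal_span; rewrite eqEsubset; split=> f.
  by move=> [i ->]; exists (U_(i) *+ d)%MM; [exists i|rewrite mpolyXn].
by move=> [_ [i _ <-] ->]; exists i; rewrite mpolyXn.
Qed.

Lemma pure_powers_mdeg d m : pure_powers d m -> mdeg m = d.
Proof. by move=> [i _ <-]; rewrite mdegMn mdeg1 mul1n. Qed.

Lemma full_height_mideal (L : set {mpoly K[n]}) :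
  (0 < n)%N -> monomial_ideal L -> equigenerated L -> has_height L n ->
  exists d M, [/\ (0 < d)%N, L = mideal M, forall m, M m -> mdeg m = d &
                  forall i, M (U_(i) *+ d)%MM].
Proof.
move=> n0 Lmon Leq Lht; have [d [M [Md LM]]] := equigenerated_mideal Lmon Leq.
rewrite LM in Lht.
have pow i : (0 < d)%N /\ M (U_(i) *+ d)%MM.
  have [k k0 Mk] := full_height_pure_powers Lht i.
  by have := Md _ Mk; rewrite mdegMn mdeg1 mul1n => <-.
by exists d, M; split=> // [|i]; [have [] := pow (Ordinal n0)|have [] := pow i].
Qed.

Lemma msumset_mdeg (A B : set 'X_{1..n}) a b m :
  (forall m, A m -> mdeg m = a) -> (forall m, B m -> mdeg m = b) ->
  msumset A B m -> mdeg m = (a + b)%N.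
Proof. by move=> Aa Bb [u /Aa <- [v /Bb <- <-]]; rewrite mdegD. Qed.

Lemma freiman_prod_mideal (A B : set 'X_{1..n}) a b :
  (0 < a)%N -> (forall m, A m -> mdeg m = a) -> (forall m, B m -> mdeg m = b) ->
  (forall i, A (U_(i) *+ a)%MM) -> (forall i, B (U_(i) *+ b)%MM) ->
  freiman (ideal_prod (mideal A) (mideal B) : set {mpoly K[n]}) <->
  forall u v, msumset A B u -> msumset A B v ->
    exists i, exists2 w, msumset A B w & (u + v = U_(i) *+ (a + b) + w)%MM.
Proof.
move=> a0 Aa Bb Apow Bpow; rewrite mideal_prod; apply: freiman_mideal.
- by rewrite addn_gt0 a0.
- by move=> m; exact: msumset_mdeg.
move=> i; exists (U_(i) *+ a)%MM => //; exists (U_(i) *+ b)%MM => //.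
by apply/mnmP => j; rewrite mnmDE !mulmnE mulnDr.
Qed.

(** A generator of the square of this product is a product of four powers
    [X_i ^ d] with three possible indices, so two of them agree. *)
Lemma freiman_pure_power_square d :
  n = 3 -> (0 < d)%N ->
  freiman (ideal_prod (pure_power_ideal K n d) (pure_power_ideal K n d)).
Proof.
move=> n3 d0; rewrite !pure_power_idealE.
apply/(freiman_prod_mideal d0 (@pure_powers_mdeg d) (@pure_powers_mdeg d)).
- by move=> i; exists i.
- by move=> i; exists i.
move=> _ _ [_ [i _ <-] [_ [j _ <-] <-]] [_ [k _ <-] [_ [l _ <-] <-]].
have V (x y : 'I_n) : msumset (pure_powers d) (pure_powers d)
    (U_(x) *+ d + U_(y) *+ d)%MM.
  by exists (U_(x) *+ d)%MM; [exists x|exists (U_(y) *+ d)%MM; [exists y|]].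
have coll (x y z t : 'I_n) : x = y ->
    (U_(i) *+ d + U_(j) *+ d + (U_(k) *+ d + U_(l) *+ d) =
     U_(x) *+ d + U_(y) *+ d + (U_(z) *+ d + U_(t) *+ d))%MM ->
    exists i', exists2 w, msumset (pure_powers d) (pure_powers d) w &
    (U_(i) *+ d + U_(j) *+ d + (U_(k) *+ d + U_(l) *+ d) =
      U_(i') *+ (d + d) + w)%MM.
  move=> xy ->; exists x, (U_(z) *+ d + U_(t) *+ d)%MM => //.
  by rewrite xy; apply/mnmP => p; rewrite !mnmDE !mulmnE mulnDr.
have [ij|ij] := eqVneq i j; first exact: (coll i j k l).
have [ik|ik] := eqVneq i k.
  by apply: (coll i k j l ik); apply/mnmP => p; rewrite !mnmDE; lia.
have [il|il] := eqVneq i l.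
  by apply: (coll i l j k il); apply/mnmP => p; rewrite !mnmDE; lia.
have [jk|jk] := eqVneq j k.
  by apply: (coll j k i l jk); apply/mnmP => p; rewrite !mnmDE; lia.
have [jl|jl] := eqVneq j l.
  by apply: (coll j l i k jl); apply/mnmP => p; rewrite !mnmDE; lia.
have [kl|kl] := eqVneq k l.
  by apply: (coll k l i j kl); apply/mnmP => p; rewrite !mnmDE; lia.
have u4 : uniq [:: i; j; k; l].
  by rewrite /= !inE !negb_or ij ik il jk jl kl.
have := uniq_leq_size u4 (s2 := enum 'I_n) (fun x _ => mem_enum 'I_n x).
by rewrite size_enum_ord /=; lia.
Qed.
End PurePowers.

Theorem corollary2p6 (K : fieldType) (n : nat) (I J : set {mpoly K[n]})
    (Imon : monomial_ideal I) (Jmon : monomial_ideal J)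
    (Ieq : equigenerated I) (Jeq : equigenerated J)
    (Iht : has_height I n) (Jht : has_height J n) :
  (n = 3 ->
     (freiman (ideal_prod I J) <->
      exists2 d : nat, (1 <= d)%N &
        I = pure_power_ideal K n d /\ J = pure_power_ideal K n d)) /\
  ((4 <= n)%N -> ~ freiman (ideal_prod I J)).
Proof.
have divides : (0 < n)%N -> freiman (ideal_prod I J) ->
    exists a b A B, [/\ I = mideal A, J = mideal B, (0 < a)%N /\ (0 < b)%N,
      (forall m, A m -> mdeg m = a) /\ (forall m, B m -> mdeg m = b) &
      [/\ forall i, A (U_(i) *+ a)%MM, forall i, B (U_(i) *+ b)%MM &
      forall u v, msumset A B u -> msumset A B v ->
        exists i, (a + b <= (u + v)%MM i)%N]].
  move=> n0.
  have [a [A [a0 IA Aa Apow]]] := full_height_mideal n0 Imon Ieq Iht.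
  have [b [B [b0 JB Bb Bpow]]] := full_height_mideal n0 Jmon Jeq Jht.
  rewrite {1}IA {1}JB => /(freiman_prod_mideal K a0 Aa Bb Apow Bpow) full.
  exists a, b, A, B; split=> //; split=> // u v Mu Mv.
  have [i [w _ ->]] := full u v Mu Mv; exists i.
  by rewrite mnmDE mulmnE mnm1E eqxx mul1n leq_addr.
split=> [n3|n4]; last first.
  move=> /divides[|a [b [A [B [_ _ [a0 b0] _ [Apow Bpow div]]]]]]; first by lia.
  pose o (i : 'I_4) := widen_ord n4 i.
  apply: (no_four_variables a0 b0 Apow Bpow div (i := o 0%R) (j := o 1%R)
    (k := o 2%R) (l := o 3%R)).
  by [].
split=> [|[d d0 [-> ->]]]; last exact: freiman_pure_power_square.
move=> /divides[|a [b [A [B [IA JB [a0 b0] [Aa Bb] [Apow Bpow div]]]]]].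
  by rewrite n3.
have le3n : (3 <= n)%N by rewrite n3.
pose o (i : 'I_3) := widen_ord le3n i.
have uo : uniq [:: o 0%R; o 1%R; o 2%R] by [].
have divC u v : msumset B A u -> msumset B A v ->
    exists i, (b + a <= (u + v)%MM i)%N.
  by rewrite addnC msumsetC; exact: div.
have ab : a = b.
  apply/eqP; rewrite eqn_leq (degree_le a0 b0 Apow Bpow div uo).
  by rewrite (degree_le b0 a0 Bpow Apow divC uo).
have AE : A = pure_powers a.
  rewrite eqEsubset; split=> [m Am|_ [i _ <-]] //.
  have [x ->] := pure_power_of_degree_eq a0 b0 Aa Apow Bpow div uo ab Am.
  by exists x.
have BE : B = pure_powers b.
  rewrite eqEsubset; split=> [m Bm|_ [i _ <-]] //.
  have [x ->] :=
    pure_power_of_degree_eq b0 a0 Bb Bpow Apow divC uo (esym ab) Bm.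
  by exists x.
by exists a => //; rewrite IA JB AE BE -ab !pure_power_idealE.
Qed.
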